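(* Let $(O,\perp)$ be an orthoset. Then $(O,\perp)$ is compatible if and only if $L(O,\perp)$ is a Boolean algebra.
   Context: An orthoset $(O,\perp)$ is a set $O$ with an irreflexive symmetric binary relation $\perp$. For $X\subseteq O$, $X^\perp=\{y\in O\mid y\perp x \text{ for all } x\in X\}$, and $x^\perp=\{x\}^\perp$. A subset $X$ is orthoclosed if $X=X^{\perp\perp}$. $L(O,\perp)$ denotes the complete ortholattice of all orthoclosed subsets of $O$ ordered by inclusion, with meet given by intersection, join $X\vee Y=(X\cup Y)^{\perp\perp}$, and orthocomplement $X\mapsto X^\perp$. The orthoset is called compatible if for all $x,y\in O$ with $x\not\perp y$ there exists $z\in O$ such that $x^\perp\cup y^\perp\subseteq z^\perp$. A Boolean algebra is an ortholattice satisfying the distributive law. *)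

(* Defs.v *)
From HB Require Import structures.
From mathcomp Require Import all_boot all_order.
From mathcomp Require Import boolp classical_sets.

Set Implicit Arguments.
Unset Strict Implicit.
Unset Printing Implicit Defensive.

Import Order.TTheory.

Local Open Scope classical_set_scope.

HB.mixin Record isOrthoset (O : Type) := {
  perp : O -> O -> Prop;
  perp_irrefl : forall x : O, ~ perp x x;
  perp_sym : forall x y : O, perp x y -> perp y x
}.

#[short(type="orthosetType")]
HB.structure Definition Orthoset := {O of isOrthoset O}.

Definition orthocompl_set (O : orthosetType) (X : set O) : set O :=
  [set y | forall x, X x -> perp y x].

Notation "X ^⊥" := (orthocompl_set X)
  (at level 1, left associativity, format "X ^⊥") : classical_set_scope.

Definition orthoclosed (O : orthosetType) (X : set O) : Prop := X = X^⊥^⊥.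

Definition compatible (O : orthosetType) : Prop :=
  forall x y : O, ~ perp x y ->
    exists z : O, [set x]^⊥ `|` [set y]^⊥ `<=` [set z]^⊥.

HB.mixin Record TBLattice_isOrtholattice d T of Order.TBLattice d T := {
  ocompl : T -> T;
  ocomplK : involutive ocompl;
  ocompl_le : forall x y : T, (x <= y)%O -> (ocompl y <= ocompl x)%O;
  meet_ocompl : forall x : T, (x `&` ocompl x = \bot)%O;
  join_ocompl : forall x : T, (x `|` ocompl x = \top)%O
}.

#[short(type="ortholatticeType")]
HB.structure Definition Ortholattice d :=
  {T of Order.TBLattice d T & TBLattice_isOrtholattice d T}.

Definition is_boolean_algebra d (L : ortholatticeType d) : Prop :=
  forall x y z : L, (x `&` (y `|` z) = (x `&` y) `|` (x `&` z))%O.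

Section OrthocomplTheory.
Context {O : orthosetType}.
Implicit Types X Y : set O.

Lemma orthocompl_subset X Y : X `<=` Y -> Y^⊥ `<=` X^⊥.
Proof. by move=> XY y Yy x /XY /Yy. Qed.

Lemma sub_orthocomplK X : X `<=` X^⊥^⊥.
Proof. by move=> x Xx y Xy; apply: perp_sym; exact: Xy. Qed.

Lemma orthocompl3 X : X^⊥^⊥^⊥ = X^⊥.
Proof.
apply/seteqP; split; last exact: sub_orthocomplK.
exact/orthocompl_subset/sub_orthocomplK.
Qed.

Lemma orthoclosed_orthocompl X : orthoclosed X^⊥.
Proof. by rewrite /orthoclosed orthocompl3. Qed.

Lemma orthoclosed_subset X Y : orthoclosed Y -> X `<=` Y -> X^⊥^⊥ `<=` Y.
Proof. by move=> cY XY; rewrite cY; exact/orthocompl_subset/orthocompl_subset. Qed.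

Lemma orthoclosedI X Y : orthoclosed X -> orthoclosed Y -> orthoclosed (X `&` Y).
Proof.
move=> cX cY; apply/seteqP; split; first exact: sub_orthocomplK.
by move=> x XYx; split; [apply: (orthoclosed_subset cX) XYx => ? []
                        |apply: (orthoclosed_subset cY) XYx => ? []].
Qed.

Lemma orthocomplI X : X `&` X^⊥ = set0.
Proof. by apply/seteqP; split=> x // [Xx /(_ x Xx)]; exact: perp_irrefl. Qed.

Lemma orthocomplT : (@setT O)^⊥ = set0.
Proof. by rewrite -(setTI (setT^⊥)) orthocomplI. Qed.

Lemma orthocompl0 : (@set0 O)^⊥ = setT.
Proof. by apply/seteqP; split=> // x _ y []. Qed.

Lemma orthoclosed0 : orthoclosed (@set0 O).
Proof. by rewrite -orthocomplT; exact: orthoclosed_orthocompl. Qed.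

Lemma orthoclosedT : orthoclosed (@setT O).
Proof. by rewrite -orthocompl0; exact: orthoclosed_orthocompl. Qed.

End OrthocomplTheory.

(* The carrier of L(O, ⊥): the subtype of set O of all orthoclosed sets. *)
Record closed_set (O : orthosetType) := ClosedSet {
  set_of_closed :> set O;
  closed_setP : `[< orthoclosed set_of_closed >]
}.

HB.instance Definition _ (O : orthosetType) := [isSub for @set_of_closed O].
HB.instance Definition _ (O : orthosetType) :=
  [Choice of closed_set O by <:].

Section ClosedSetLattice.
Context {O : orthosetType}.
Implicit Types X Y Z : closed_set O.

Lemma closedP X : orthoclosed X.
Proof. exact/asboolP/closed_setP. Qed.

Definition mk_closed (X : set O) (cX : orthoclosed X) : closed_set O :=
  ClosedSet (asboolT cX).

Definition closed_le X Y : bool := `[< X `<=` Y >].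
Definition closed_meet X Y : closed_set O :=
  mk_closed (orthoclosedI (closedP X) (closedP Y)).
Definition closed_join X Y : closed_set O :=
  mk_closed (orthoclosed_orthocompl (X `|` Y)^⊥).
Definition closed_compl X : closed_set O :=
  mk_closed (orthoclosed_orthocompl X).
Definition closed_bot : closed_set O := mk_closed orthoclosed0.
Definition closed_top : closed_set O := mk_closed orthoclosedT.

Lemma closed_le_refl : reflexive closed_le.
Proof. by move=> X; exact/asboolP. Qed.

Lemma closed_le_anti : antisymmetric closed_le.
Proof.
by move=> X Y /andP[/asboolP XY /asboolP YX]; apply/val_inj/seteqP.
Qed.

Lemma closed_le_trans : transitive closed_le.
Proof.
move=> Y X Z /asboolP XY /asboolP YZ; apply/asboolP.
exact: subset_trans YZ.
Qed.

HB.instance Definition _ := Order.Le_isPOrder.Build (Order.Disp tt tt)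
  (closed_set O) closed_le_refl closed_le_anti closed_le_trans.

Lemma closed_meetP X Y Z : (X <= closed_meet Y Z)%O = (X <= Y)%O && (X <= Z)%O.
Proof.
apply/asboolP/andP => [XYZ|[/asboolP XY /asboolP XZ] x Xx].
  by split; apply/asboolP => x /XYZ [].
by split; [exact: XY|exact: XZ].
Qed.

Lemma closed_joinP X Y Z : (closed_join X Y <= Z)%O = (X <= Z)%O && (Y <= Z)%O.
Proof.
apply/asboolP/andP => [XYZ|[/asboolP XZ /asboolP YZ]].
  by split; apply/asboolP => x Xx; apply: XYZ; apply: sub_orthocomplK;
    [left|right].
by apply: orthoclosed_subset (closedP Z) _ => x [/XZ|/YZ].
Qed.

Lemma closed_le0 X : (closed_bot <= X)%O.
Proof. exact/asboolP. Qed.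

Lemma closed_le1 X : (X <= closed_top)%O.
Proof. exact/asboolP. Qed.

HB.instance Definition _ := Order.POrder_MeetJoin_isLattice.Build
  (Order.Disp tt tt) (closed_set O) closed_meetP closed_joinP.
HB.instance Definition _ := Order.hasBottom.Build
  (Order.Disp tt tt) (closed_set O) closed_le0.
HB.instance Definition _ := Order.hasTop.Build
  (Order.Disp tt tt) (closed_set O) closed_le1.

Lemma closed_complK : involutive closed_compl.
Proof. by move=> X; apply/val_inj; rewrite /= -closedP. Qed.

Lemma closed_compl_le X Y :
  (X <= Y)%O -> (closed_compl Y <= closed_compl X)%O.
Proof. by move=> /asboolP XY; apply/asboolP; exact: orthocompl_subset. Qed.

Lemma meet_closed_compl X : (X `&` closed_compl X = \bot)%O.
Proof. by apply/val_inj; exact: orthocomplI. Qed.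

Lemma join_closed_compl X : (X `|` closed_compl X = \top)%O.
Proof.
apply: (inv_inj closed_complK); apply/val_inj => /=.
rewrite orthocompl3 orthocomplT; apply/seteqP; split=> // x XXx.
by apply: (@perp_irrefl O x); apply: (XXx); right=> y Xy; apply: (XXx); left.
Qed.

HB.instance Definition _ := TBLattice_isOrtholattice.Build
  (Order.Disp tt tt) (closed_set O)
  closed_complK closed_compl_le meet_closed_compl join_closed_compl.

End ClosedSetLattice.

Definition orthoset_lattice (O : orthosetType) :
  ortholatticeType (Order.Disp tt tt) := closed_set O.

(* Main.v *)
Require Import Defs.
From mathcomp Require Import all_boot all_order.
From mathcomp Require Import boolp classical_sets.

(** Both properties say that disjoint elements of L(O, ⊥) are orthogonal.  In an
    ortholattice this amounts to distributivity: if e is the meet of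
    x ∧ (y ∨ z) with the complement of (x ∧ y) ∨ (x ∧ z), then e is disjoint
    from y and from z, hence orthogonal to y ∨ z; but e lies below y ∨ z, so
    e = 0.  In an orthoset, the points z with x^⊥ ∪ y^⊥ ⊆ z^⊥ are exactly those
    of x^⊥⊥ ∩ y^⊥⊥, so compatibility says that x ⊥ y as soon as x^⊥⊥ and y^⊥⊥
    are disjoint; these are the least orthoclosed sets containing x and y. *)

Import Order.TTheory.
Local Open Scope classical_set_scope.

Lemma leU_meetUr {d} {L : latticeType d} (x y z : L) :
  ((x `&` y) `|` (x `&` z) <= x `&` (y `|` z))%O.
Proof. by rewrite leUx !leI2 ?leUl ?leUr. Qed.

Definition disjoint_orthogonal {d} (L : ortholatticeType d) : Prop :=
  forall x y : L, (x `&` y = \bot)%O -> (x <= ocompl y)%O.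

Section OrtholatticeTheory.
Local Open Scope order_scope.
Context {d : Order.disp_t} {L : ortholatticeType d}.
Implicit Types x y z : L.

Lemma le_ocomplC x y : (x <= ocompl y) = (y <= ocompl x).
Proof. by apply/idP/idP=> /ocompl_le; rewrite ocomplK. Qed.

Lemma le_ocompl_eq0 x y : x <= y -> x <= ocompl y -> x = \bot.
Proof.
by move=> le_xy le_xcy; apply/eqP; rewrite -lex0 -(meet_ocompl y) lexI le_xy.
Qed.

Lemma boolean_disjoint_orthogonal :
  is_boolean_algebra L -> disjoint_orthogonal L.
Proof.
move=> distr x y xy0; have := distr x y (ocompl y).
by rewrite join_ocompl meetx1 xy0 join0x => ->; exact: leIr.
Qed.

Lemma disjoint_orthogonal_boolean :
  disjoint_orthogonal L -> is_boolean_algebra L.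
Proof.
move=> disj_orth x y z; apply/le_anti; rewrite leU_meetUr andbT.
set a := x `&` (y `|` z); set b := _ `|` _.
pose e := a `&` ocompl b.
have e_le_x : e <= x by rewrite leIxl ?leIl.
have le_ocompl_e t : x `&` t <= b -> t <= ocompl e.
  move=> xt_le_b; rewrite le_ocomplC; apply: disj_orth.
  apply: (le_ocompl_eq0 _ b); first by apply: le_trans xt_le_b; exact: leI2.
  by rewrite leIxl ?leIr.
have yz_le_ocompl_e : y `|` z <= ocompl e.
  by rewrite leUx !le_ocompl_e ?leUl ?leUr.
have e_le_yz : e <= y `|` z by rewrite leIxl ?leIr.
have e0 : e = \bot by apply: (le_ocompl_eq0 _ _ e_le_yz); rewrite le_ocomplC.
by rewrite -(ocomplK b); exact: disj_orth.
Qed.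

Lemma is_boolean_algebraP : is_boolean_algebra L <-> disjoint_orthogonal L.
Proof.
split; [exact: boolean_disjoint_orthogonal|exact: disjoint_orthogonal_boolean].
Qed.

End OrtholatticeTheory.

Section OrthosetTheory.
Context {O : orthosetType}.
Implicit Types (x y z : O) (A B : set O).

Lemma sub_orthocomplC A B : A `<=` B^⊥ <-> B `<=` A^⊥.
Proof. by split=> AB y By x /AB; move/(_ y By)/perp_sym. Qed.

Lemma orthocompl2P A z : A^⊥^⊥ z <-> A^⊥ `<=` [set z]^⊥.
Proof. by rewrite sub_orthocomplC; split=> [Az _ ->|]; last apply. Qed.

Lemma compatible_witnessP x y z :
  [set x]^⊥ `|` [set y]^⊥ `<=` [set z]^⊥ <->
  ([set x]^⊥^⊥ `&` [set y]^⊥^⊥) z.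
Proof. by rewrite subUset; split=> -[/orthocompl2P xz /orthocompl2P yz]. Qed.

Lemma compatible_set1P :
  compatible O <->
  forall x y, [set x]^⊥^⊥ `&` [set y]^⊥^⊥ = set0 -> perp x y.
Proof.
split=> [cO x y xy0|disj_perp x y xy].
  by apply: contrapT => /cO[z /compatible_witnessP]; rewrite xy0.
have /eqP/set0P[z xyz] : [set x]^⊥^⊥ `&` [set y]^⊥^⊥ <> set0.
  by move=> /disj_perp.
by exists z; apply/compatible_witnessP.
Qed.

Lemma compatible_orthoclosedP :
  compatible O <->
  forall A B, orthoclosed A -> orthoclosed B -> A `&` B = set0 -> A `<=` B^⊥.
Proof.
rewrite compatible_set1P.
split=> [disj_perp A B cA cB AB0 x Ax y By|disj_orth x y xy0].
  apply: disj_perp; rewrite -subset0 -AB0.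
  by apply: setISS; apply: orthoclosed_subset => // _ ->.
have : [set x]^⊥^⊥ `<=` [set y]^⊥^⊥^⊥.
  by apply: disj_orth xy0; exact: orthoclosed_orthocompl.
by rewrite orthocompl3; apply=> //; exact: sub_orthocomplK.
Qed.

Lemma compatible_disjoint_orthogonal :
  compatible O <-> disjoint_orthogonal (orthoset_lattice O).
Proof.
rewrite compatible_orthoclosedP.
split=> [disj_orth X Y XY0|disj_orth A B cA cB AB0].
  apply/asboolP/disj_orth; [exact: closedP|exact: closedP|].
  exact: (congr1 (@set_of_closed O) XY0).
apply/asboolP/(disj_orth (mk_closed cA : orthoset_lattice O) (mk_closed cB)).
exact/val_inj.
Qed.

End OrthosetTheory.

Theorem theorem3p2 (O : orthosetType) :
  compatible O <-> is_boolean_algebra (orthoset_lattice O).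
Proof. by rewrite is_boolean_algebraP compatible_disjoint_orthogonal. Qed.
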